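(* Let $\mathcal F=\{f_i(x)=r_ix+b_i\}_{i=1}^m$ be an affine reverse iterated function system on $\mathbb R$, with $r_i,b_i\in\mathbb R$ and $|r_i|>1$ for all $i$. Then $d_{\mathcal F}=0$ if and only if $\mathcal F$ is degenerate. Moreover, if $\mathcal F$ is degenerate and $r_1,\dots,r_m$ are algebraic numbers, then $$\dim_{\mathrm{Be}}\mathcal O^+_{\mathcal F}(a)=0$$ for every $a\in\mathbb R$.
   Context: The maps $f_1,\dots,f_m$ are distinct. $G^*(\mathcal F)$ is the semigroup of distinct maps generated by $\mathcal F$ under composition (all nonempty finite compositions), $|g'|$ is the absolute value of the linear coefficient of the affine map $g$, and $$d_{\mathcal F}=\lim_{R\to\infty}\frac{\log\#\{g\in G^*(\mathcal F):|g'|\le R\}}{\log R},$$ a limit which always exists. $\mathcal F$ is degenerate if all the maps $f_i$ have a common fixed point. The forward orbit of $a$ is $\mathcal O^+_{\mathcal F}(a)=\{g(a):g\in G^*(\mathcal F)\}$. For $E\subseteq\mathbb R$, the Beurling dimension is $\dim_{\mathrm{Be}}E=\inf\{\alpha>0:\mathcal D^+_\alpha(E)<\infty\}$ (with $\inf\varnothing=\infty$), where $\mathcal D_\alpha^+(E)=\limsup_{h\to\infty}\sup_{x\in\mathbb R}\#(E\cap[x-h,x+h])/h^\alpha$. *)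

(* Defs.v *)
From HB Require Import structures.
From mathcomp Require Import all_boot all_order all_algebra.
From mathcomp Require Import finmap.
From mathcomp Require Import all_classical all_reals all_analysis.

Set Implicit Arguments.
Unset Strict Implicit.
Unset Printing Implicit Defensive.

Import Order.TTheory GRing.Theory Num.Theory.
Import numFieldNormedType.Exports.

Local Open Scope classical_set_scope.
Local Open Scope ring_scope.

Definition affine_map (R : realType) (c d : R) : R -> R := fun x => c * x + d.

Definition affine_system (R : realType) (m : nat) (r b : 'I_m -> R) :
    'I_m -> R -> R :=
  fun i => affine_map (r i) (b i).

(* Elements are maps, not words: two compositions that agree as functions
   are the same element. The identity is not included a priori. *)
Inductive gen_semigroup (I T : Type) (F : I -> T -> T) : (T -> T) -> Prop :=
| gen_semigroup_gen (i : I) : gen_semigroup F (F i)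
| gen_semigroup_comp (g h : T -> T) :
    gen_semigroup F g -> gen_semigroup F h -> gen_semigroup F (g \o h).

(* {g in G*(F) : |g'| <= t}, where |g'| = |c| when g(x) = c x + d. *)
Definition growth_ball (R : realType) (I : Type) (F : I -> R -> R) (t : R) :
    set (R -> R) :=
  [set g | gen_semigroup F g /\
           exists c d : R, g = affine_map c d /\ `|c| <= t].

(* For a finite affine system with all |r_i| > 1, every growth_ball is finite
   and the limit exists; the values taken by fset_set on infinite sets and by
   lim on divergent functions are not meant to be used. *)
Definition growth_dim (R : realType) (I : Type) (F : I -> R -> R) : R :=
  lim ((ln (#|` fset_set (growth_ball F t)|%:R : R) / ln t)
         @[t --> (+oo : set_system R)]).

Definition degenerate (I T : Type) (F : I -> T -> T) : Prop :=
  exists p : T, forall i : I, F i p = p.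

Definition forward_orbit (I T : Type) (F : I -> T -> T) (a : T) : set T :=
  [set g a | g in [set g | gen_semigroup F g]].

(* counting is +oo on infinite sets, so that the density may be infinite. *)
Definition upper_beurling_density (R : realType) (alpha : R) (E : set R) :
    \bar R :=
  limf_esup
    (fun h : R => ereal_sup (range (fun x : R =>
       (counting (E `&` [set y | (x - h <= y <= x + h)%R]) *
        ((h `^ alpha)^-1)%:E)%E)))
    (pinfty_nbhs R).

Definition beurling_dim (R : realType) (E : set R) : \bar R :=
  ereal_inf [set alpha%:E | alpha in
    [set alpha : R | 0 < alpha /\ (upper_beurling_density alpha E < +oo)%E]].

(* Main.v *)
Require Import Defs.
From HB Require Import structures.
From mathcomp Require Import all_boot all_order all_algebra.
From mathcomp Require Import perm finmap.
From mathcomp Require Import all_classical all_reals all_analysis.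
From mathcomp Require Import ring lra zify.
Import Order.TTheory GRing.Theory Num.Theory.
Import numFieldNormedType.Exports.
Local Open Scope ring_scope.

(** If all maps fix a point [p], an element of the semigroup is determined by
    its slope, which is a monomial in the [r i]. With [rho > 1] below all the
    [|r i|], a monomial of absolute value at most [t < rho ^+ n.+1] has
    exponents at most [n], so there are at most [n.+1 ^ m] of them: the count
    is polynomial in [ln t] and the growth dimension is [0]
    ([growth_dim_degenerate]).

    If the maps have no common fixed point, two of them, [F i] and [F j], have
    distinct fixed points, and then so have their iterates. Composing high
    iterates of both in the two possible orders gives two maps of the same
    slope [sigma], [|sigma| >= 2], with distinct translation parts. The words
    of length [n] in these two maps all have slope [sigma ^+ n], and their
    translation parts are pairwise distinct expansions in base [sigma], so the
    ball of radius [|sigma| ^+ n] has at least [2 ^ n] elements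
    ([nondegenerate_growth]). This excludes the limit [0]; since [lim] has a
    conventional value on divergent functions, the limit must also be shown to
    exist. Cutting a word at the first moment when its slope exceeds [s] shows
    that the growth function is submultiplicative up to a constant
    ([growth_ball_submul]), and the limit is then Fekete's ([fekete_cvg]).

    For the Beurling dimension, the orbit of [a] consists of points
    [p + mono r k * (a - p)]. Monomials in algebraic numbers satisfy a
    Liouville inequality: a nonzero difference [mono r k - mono r l] is at
    least [K ^- w] times [|mono r k|] when the exponents differ by at most [w]
    ([mono_gap]). Suppose that many monomials of size about [rho ^+ n] lie
    within distance [H] of each other. By pigeonhole two of them have
    exponents that differ by a small fraction of [n], hence their distance is
    at least half the square root of [rho ^+ n], which forces
    [rho ^+ n <= 4 * H ^+ 2]. So the number of monomials in an interval of
    length [H] is either bounded or polylogarithmic in [H] ([mono_cluster]),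
    hence [O(H ^ alpha)] for every positive [alpha].

    The Liouville inequality is obtained by letting the numbers act on a
    finitely generated group of reals. After multiplication by integers, the
    [r i] become roots of monic integer polynomials, so that multiplication by
    each of them is given by an integer matrix on the same finite family of
    reals ([int_action_exists]). An integer multiple of the difference of two
    monomials, with an exponentially bounded factor, is then an eigenvalue of
    an integer matrix with exponentially bounded entries, and a nonzero root
    of an integer polynomial is, in absolute value, at least the inverse of
    the sum of the absolute values of the coefficients
    ([int_root_lower_bound]). *)

Set Implicit Arguments.
Unset Strict Implicit.
Unset Printing Implicit Defensive.

(** * The l1 norm of integer polynomials *)

Section PolyL1.

Implicit Types p q : {poly int}.

(** The sum of the absolute values of the coefficients of [p]. *)
Definition poly_l1 p : int := \sum_(i < size p) `|p`_i|.

Lemma poly_l1E p n : (size p <= n)%N -> poly_l1 p = \sum_(i < n) `|p`_i|.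
Proof.
move=> le_pn; rewrite /poly_l1 (big_ord_widen n (fun i => `|p`_i|) le_pn).
rewrite big_mkcond /=; apply: eq_bigr => i _.
by case: ltnP => // le_pi; rewrite nth_default // normr0.
Qed.

Lemma poly_l1_ge0 p : 0 <= poly_l1 p.
Proof. exact: sumr_ge0. Qed.

Lemma poly_l1D p q : poly_l1 (p + q) <= poly_l1 p + poly_l1 q.
Proof.
pose n := maxn (size p) (size q).
rewrite !(@poly_l1E _ n) ?leq_maxl ?leq_maxr ?size_polyD //.
rewrite -big_split /=; apply: ler_sum => i _.
by rewrite coefD ler_normD.
Qed.

Lemma poly_l1_sum (I : Type) (s : seq I) (P : pred I) (F : I -> {poly int}) :
  poly_l1 (\sum_(i <- s | P i) F i) <= \sum_(i <- s | P i) poly_l1 (F i).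
Proof.
elim/big_rec2: _ => [|i x y _ le_yx];
  first by rewrite /poly_l1 size_poly0 big_ord0.
exact: le_trans (poly_l1D _ _) (lerD (lexx _) le_yx).
Qed.

Lemma poly_l1C (c : int) : poly_l1 c%:P = `|c|.
Proof.
by rewrite (@poly_l1E _ 1) ?size_polyC_leq1 // big_ord1 coefC.
Qed.

Lemma poly_l1Z (c : int) p : poly_l1 (c *: p) = `|c| * poly_l1 p.
Proof.
rewrite (@poly_l1E _ (size p)) ?size_scale_leq // mulr_sumr.
by apply: eq_bigr => i _; rewrite coefZ normrM.
Qed.

Lemma poly_l1N p : poly_l1 (- p) = poly_l1 p.
Proof. by rewrite -scaleN1r poly_l1Z normrN normr1 mul1r. Qed.

Lemma poly_l1MX p : poly_l1 (p * 'X) = poly_l1 p.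
Proof.
rewrite (@poly_l1E _ (size p).+1); last first.
  by apply: leq_trans (size_polyMleq _ _) _; rewrite size_polyX addnS addn1.
rewrite big_ord_recl coefMX eqxx normr0 add0r.
by apply: eq_bigr => i _; rewrite coefMX.
Qed.

Lemma poly_l1M p q : poly_l1 (p * q) <= poly_l1 p * poly_l1 q.
Proof.
have l1MXn n (u : {poly int}) : poly_l1 (u * 'X^n) = poly_l1 u.
  by elim: n => [|n IHn]; rewrite ?expr0 ?mulr1 // exprSr mulrA poly_l1MX.
rewrite -{1}[p]coefK poly_def mulr_suml.
apply: le_trans (poly_l1_sum _ _ _) _.
rewrite [in leRHS]/poly_l1 mulr_suml; apply: ler_sum => i _.
by rewrite -scalerAl poly_l1Z mulrC [_ * q]mulrC l1MXn mulrC.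
Qed.

Lemma poly_l1_prod (I : finType) (F : I -> {poly int}) (B : int) :
  (forall i, poly_l1 (F i) <= B) -> poly_l1 (\prod_i F i) <= B ^+ #|I|.
Proof.
move=> leFB; rewrite -prodr_const; elim/big_rec2: _ => [|i x y _ le_yx].
  by rewrite poly_l1C.
apply: le_trans (poly_l1M _ _) _.
by apply: ler_pM; rewrite ?poly_l1_ge0.
Qed.

Lemma poly_l1_char_poly n (T : 'M[int]_n) (B : int) :
  (forall i j, `|T i j| <= B) -> poly_l1 (char_poly T) <= (n`!)%:R * (1 + B) ^+
    n.
Proof.
move=> leTB; apply: le_trans (poly_l1_sum _ _ _) _.
have -> : (n`!)%:R * (1 + B) ^+ n = \sum_(s : 'S_n) (1 + B) ^+ n.
  by rewrite sumr_const card_Sn mulr_natl.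
apply: ler_sum => s _.
apply: le_trans (poly_l1M _ _) _.
have -> : poly_l1 ((-1) ^+ s) = 1.
  by case: (s : bool); rewrite ?expr1 ?expr0 ?poly_l1N -?polyC1 poly_l1C.
rewrite mul1r -[X in _ <= _ ^+ X](card_ord n); apply: poly_l1_prod => i.
rewrite !mxE; apply: le_trans (poly_l1D _ _) _.
rewrite poly_l1N poly_l1C lerD // -mulr_natr.
apply: le_trans (poly_l1M _ _) _.
have -> : poly_l1 'X = 1 by rewrite -[X in poly_l1 X]mul1r poly_l1MX poly_l1C.
by rewrite mul1r; case: (i == _); rewrite -polyC_natr poly_l1C.
Qed.

Variable R : realFieldType.

(** A nonzero root of an integer polynomial cannot be very small: compare the
    term of lowest degree, whose coefficient is a nonzero integer, with the
    terms of higher degree. *)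
Lemma int_root_lower_bound p (x : R) :
  p != 0 -> root (map_poly intr p) x -> x != 0 -> `|x| <= 1 ->
  1 <= `|x| * (poly_l1 p)%:~R.
Proof.
move=> p_neq0 /rootP px0 x_neq0 lex1.
have size_p : (0 < size p)%N by rewrite size_poly_gt0.
have exj : exists j, p`_j != 0.
  by exists (size p).-1; rewrite -lead_coefE lead_coef_eq0.
have [j pj_neq0 minj] := ex_minnP exj.
have x_gt0 : 0 < `|x| by rewrite normr_gt0.
have xj_gt0 : 0 < `|x| ^+ j by rewrite exprn_gt0.
have lt_jp : (j < size p)%N.
  by rewrite ltnNge; apply: contraNN pj_neq0 => le_pj; rewrite nth_default.
rewrite horner_coef size_map_poly_id0 in px0; last first.
  by rewrite intr_eq0 lead_coef_eq0.
rewrite (bigD1 (Ordinal lt_jp)) //= coef_map /= in px0.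
have {px0} eqj : (p`_j)%:~R * x ^+ j =
    - \sum_(i < size p | i != Ordinal lt_jp) (map_poly intr p)`_i * x ^+ i.
  by apply/eqP; rewrite -addr_eq0 px0.
have : `|x| ^+ j <= `|(p`_j)%:~R * x ^+ j|.
  rewrite normrM normrX; apply: ler_peMl; first exact: ltW.
  by rewrite -intr_norm ler1z -gtz0_ge1 normr_gt0.
rewrite eqj normrN => /le_trans/(_ (ler_norm_sum _ _ _)) le_sum.
have {}le_sum : `|x| ^+ j <=
    \sum_(i < size p) `|p`_i|%:~R * (`|x| ^+ j * `|x|).
  apply: le_trans le_sum _.
  rewrite [leRHS](bigD1 (Ordinal lt_jp)) //=.
  rewrite -[leLHS]add0r; apply: lerD.
    by apply: mulr_ge0; rewrite ?ler0z // mulr_ge0 // ltW.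
  apply: ler_sum => i neq_ij; rewrite coef_map /= normrM normrX -intr_norm.
  have [lt_ij|le_ji] := ltnP i j.
    have /eqP -> : p`_i == 0.
      by apply: contraTT lt_ij => /minj; rewrite -leqNgt.
    by rewrite normr0 !mul0r.
  have lt_ji : (j < i)%N.
    by rewrite ltn_neqAle le_ji andbT eq_sym;
      apply: contraNN neq_ij => /eqP eq_ij; apply/eqP/val_inj.
  rewrite ler_wpM2l ?ler0z // -exprSr.
  by apply: ler_wiXn2l.
move: le_sum; rewrite -mulr_suml -raddf_sum -/(poly_l1 p) mulrCA.
by rewrite -[X in X <= _]mulr1 ler_pM2l // mulrC.
Qed.

End PolyL1.

(** * Real numbers acting by bounded integer matrices *)

Section IntegerAction.

Variable R : realFieldType.

(** Multiplication by [z] maps each member of the family [v] to an integer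
    combination of members of [v], with coefficients of absolute sum at most
    [B].  Equivalently, [T v = z v] for an integer matrix [T] whose rows have
    l1 norm at most [B]. *)
Definition int_action (J : finType) (v : J -> R) (z : R) (B : int) : Prop :=
  forall e, exists2 t : J -> int,
    z * v e = \sum_f (t f)%:~R * v f & \sum_f `|t f| <= B.

Section Basis.
Variables (J : finType) (v : J -> R).

Lemma int_action_int (n : int) : int_action v n%:~R `|n|.
Proof.
move=> e; exists (fun f => if f == e then n else 0).
  rewrite (bigD1 e) //= eqxx big1 ?addr0 // => f /negbTE ->.
  by rewrite mul0r.
rewrite (bigD1 e) //= eqxx big1 ?addr0 // => f /negbTE ->.
by rewrite normr0.
Qed.

Lemma int_action_ge0 (e : J) z B : int_action v z B -> 0 <= B.
Proof. by move=> /(_ e)[t _]; apply: le_trans; apply: sumr_ge0. Qed.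

Lemma int_action_le z B B' : B <= B' -> int_action v z B -> int_action v z B'.
Proof.
by move=> leBB' zB e; have [t ? leB] := zB e; exists t;
  rewrite // (le_trans leB).
Qed.

Lemma int_actionB x y B C :
  int_action v x B -> int_action v y C -> int_action v (x - y) (B + C).
Proof.
move=> xB yC e; have [t xt tB] := xB e; have [u yu uC] := yC e.
exists (fun f => t f - u f).
  rewrite mulrBl xt yu -sumrB; apply: eq_bigr => f _.
  by rewrite rmorphB mulrBl.
apply: le_trans (lerD tB uC); rewrite -big_split /=.
by apply: ler_sum => f _; exact: ler_normB.
Qed.

Lemma int_actionM x y B C :
  int_action v x B -> int_action v y C -> int_action v (x * y) (B * C).
Proof.
move=> xB yC e; have [u yu uC] := yC e.
have B_ge0 := int_action_ge0 e xB.
have [t xt tB] := fin_all_exists2 xB.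
exists (fun g => \sum_f u f * t f g).
  rewrite -mulrA yu mulr_sumr.
  transitivity (\sum_f \sum_g (u f * t f g)%:~R * v g); last first.
    rewrite exchange_big; apply: eq_bigr => g _ /=.
    by rewrite -mulr_suml rmorph_sum.
  apply: eq_bigr => f _; rewrite mulrCA xt mulr_sumr.
  by apply: eq_bigr => g _; rewrite rmorphM mulrA.
apply: (@le_trans _ _ (\sum_f `|u f| * B)); last first.
  by rewrite -mulr_suml mulrC ler_wpM2l.
apply: (@le_trans _ _ (\sum_g \sum_f `|u f| * `|t f g|)).
  apply: ler_sum => g _; apply: le_trans (ler_norm_sum _ _ _) _.
  by apply: ler_sum => f _; rewrite normrM.
rewrite exchange_big; apply: ler_sum => f _ /=.
by rewrite -mulr_sumr ler_wpM2l.
Qed.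

Lemma int_action1 : int_action v 1 1.
Proof. by have := int_action_int 1; rewrite normr1. Qed.

Lemma int_actionX x B n : int_action v x B -> int_action v (x ^+ n) (B ^+ n).
Proof.
move=> xB; elim: n => [|n IHn]; first by rewrite !expr0; exact: int_action1.
by rewrite !exprS; exact: int_actionM.
Qed.

Lemma int_action_prod (I : Type) (s : seq I) (x : I -> R) (B : I -> int) :
  (forall i, int_action v (x i) (B i)) ->
  int_action v (\prod_(i <- s) x i) (\prod_(i <- s) B i).
Proof.
move=> xB; elim: s => [|i s IHs]; first by rewrite !big_nil; exact: int_action1.
by rewrite !big_cons; exact: int_actionM.
Qed.

(** The matrix through which [z] acts has [z] as an eigenvalue, so [z] is a
    root of its characteristic polynomial. *)
Lemma int_action_lower_bound (e : J) z B :
  v e != 0 -> int_action v z B -> z != 0 ->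
  1 <= `|z| * ((#|J| `!)%:R * (1 + B) ^+ #|J|)%:~R.
Proof.
move=> ve_neq0 zB z_neq0; have B_ge0 := int_action_ge0 e zB.
have [t zt tB] := fin_all_exists2 zB.
set M := (_ * _ : int).
have M_ge1 : 1 <= M%:~R :> R.
  rewrite ler1z /M mulr_ege1 ?exprn_ege1 ?lerDl //.
  by rewrite ler1n fact_gt0.
have [lt1z|lez1] := ltP 1 `|z|.
  by apply: le_trans (ltW lt1z) _; rewrite ler_peMr.
pose T : 'M[int]_#|J| := \matrix_(i, j) t (enum_val j) (enum_val i).
pose w : 'rV[R]_#|J| := \row_i v (enum_val i).
have eigz : eigenvalue (map_mx intr T) z.
  apply/eigenvalueP; exists w.
    apply/rowP => j; rewrite !mxE zt (reindex _ (onW_bij _ (@enum_val_bij J))).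
    by apply: eq_bigr => i _; rewrite !mxE mulrC.
  apply: contraNneq ve_neq0 => /rowP/(_ (enum_rank e)).
  by rewrite !mxE enum_rankK => ->.
rewrite eigenvalue_root_char -map_char_poly in eigz.
apply: le_trans (int_root_lower_bound _ eigz z_neq0 lez1) _.
  by rewrite monic_neq0 ?char_poly_monic.
rewrite ler_wpM2l ?ler_int //; apply: poly_l1_char_poly => i j.
rewrite mxE; apply: le_trans (tB (enum_val j)).
by rewrite (bigD1 (enum_val i)) //= lerDl sumr_ge0.
Qed.

End Basis.

Lemma int_action_tensor (J K : finType) (v : J -> R) (w : K -> R) x y B C :
  int_action v x B -> int_action w y C ->
  int_action (fun p : J * K => v p.1 * w p.2) (x * y) (B * C).
Proof.
move=> xB yC [e k] /=; have [t xt tB] := xB e; have [u yu uC] := yC k.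
exists (fun p => t p.1 * u p.2).
  rewrite mulrACA xt yu mulr_suml.
  rewrite (eq_bigr _ (fun _ _ => mulr_sumr _ _ _ _)) pair_big /=.
  by apply: eq_bigr => p _; rewrite rmorphM mulrACA.
have -> : \sum_p `|t p.1 * u p.2| = (\sum_f `|t f|) * \sum_g `|u g|.
  rewrite mulr_suml (eq_bigr _ (fun _ _ => mulr_sumr _ _ _ _)) pair_big /=.
  by apply: eq_bigr => p _; rewrite normrM.
by rewrite ler_pM // sumr_ge0.
Qed.

(** A root of a monic integer polynomial acts on its own first powers through
    the companion matrix. *)
Lemma int_action_powers (z : R) (d : nat) (c : 'I_d.+1 -> int) :
  z ^+ d.+1 = \sum_(j < d.+1) (c j)%:~R * z ^+ j ->
  exists B, int_action (fun j : 'I_d.+1 => z ^+ j) z B.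
Proof.
move=> zd; exists (1 + \sum_j `|c j|) => e; rewrite -exprS.
have [->|neq_ed] := eqVneq e ord_max.
  by exists c => //; rewrite lerDr.
have lt_ed : (e < d)%N.
  by rewrite ltn_neqAle -ltnS ltn_ord andbT; apply: contraNN neq_ed => /eqP ?;
    apply/eqP/val_inj.
pose e1 := @Ordinal d.+1 e.+1 lt_ed.
exists (fun j => if j == e1 then 1 else 0).
  rewrite (bigD1 e1) //= eqxx mul1r big1 ?addr0 // => f /negbTE ->.
  by rewrite mul0r.
rewrite (bigD1 e1) //= eqxx big1 ?addr0 ?normr1 ?lerDl ?sumr_ge0 //.
by move=> f /negbTE ->; rewrite normr0.
Qed.

(** [z] is a root of a monic integer polynomial of positive degree, that is,
    a real algebraic integer. *)
Definition int_monic_root (z : R) : Prop :=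
  exists d (c : 'I_d.+1 -> int),
    z ^+ d.+1 = \sum_(j < d.+1) (c j)%:~R * z ^+ j.

(** Finitely many algebraic integers act on one common family, the tensor
    product of the families of their powers. *)
Lemma int_action_exists (s : seq R) :
  (forall z, z \in s -> int_monic_root z) ->
  exists (J : finType) (v : J -> R) (e : J),
    v e != 0 /\ forall z, z \in s -> exists B, int_action v z B.
Proof.
elim: s => [_|z s IHs zsP].
  by exists unit, (fun=> 1), tt; split; rewrite ?oner_eq0.
have [y ys|J [v [e [ve_neq0 vP]]]] := IHs.
  by apply: zsP; rewrite inE ys orbT.
have [d [c zd]] := zsP z (mem_head _ _).
exists (J * 'I_d.+1)%type, (fun p : J * 'I_d.+1 => v p.1 * z ^+ p.2), (e, ord0).
split => [|y]; first by rewrite expr0 mulr1.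
rewrite inE => /predU1P[->|/vP[B yB]].
  have [B zB] := int_action_powers zd; exists (1 * B).
  by have := int_action_tensor (int_action1 v) zB; rewrite mul1r.
pose w (j : 'I_d.+1) := z ^+ j.
exists (B * 1).
by have := int_action_tensor yB (int_action1 w); rewrite mulr1.
Qed.

(** The leading coefficient of an integer polynomial that kills [x] turns [x]
    into an algebraic integer. *)
Lemma algebraic_int_multiple (x : R) :
  algebraicOver (ratr : rat -> R) x ->
  exists2 a : int, a != 0 & int_monic_root (a%:~R * x).
Proof.
move=> [p p_neq0 px0].
have [q [a a_neq0 pE]] := rat_poly_scale p.
have q_neq0 : q != 0.
  by apply: contraNneq p_neq0 => q0; rewrite pE q0 map_poly0 scaler0.
have {px0} qx0 : (map_poly intr q).[x] = 0 :> R.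
  move/rootP: px0; rewrite pE map_polyZ hornerZ -map_poly_comp.
  move/eqP; rewrite mulf_eq0 fmorph_eq0 invr_eq0 intr_eq0 (negPf a_neq0) /=.
  by move/eqP <-; congr (_.[x]); apply: eq_map_poly => n /=; rewrite ratr_int.
set b := lead_coef q; have b_neq0 : b != 0 by rewrite lead_coef_eq0.
have [d size_q] : exists d, size q = d.+2.
  case Dn: (size q) => [|[|d]]; last by exists d.
    by move/eqP: Dn; rewrite size_poly_eq0 (negPf q_neq0).
  have /size_poly1P[c c_neq0 qc] : size q == 1 by rewrite Dn.
  move: qx0; rewrite qc map_polyC hornerC => /eqP.
  by rewrite intr_eq0 (negPf c_neq0).
exists b => //; exists d, (fun j => - (q`_j * b ^+ (d - j))).
rewrite horner_coef size_map_poly_id0 ?intr_eq0 ?lead_coef_eq0 // size_q in qx0.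
rewrite big_ord_recr /= coef_map /= -/b in qx0.
have {}qx0 : b%:~R * x ^+ d.+1 = - \sum_(i < d.+1) (q`_i)%:~R * x ^+ i.
  apply/eqP; rewrite -addr_eq0 addrC -[X in _ == X]qx0; apply/eqP.
  congr (_ + _); last by rewrite /b lead_coefE size_q.
  by apply: eq_bigr => i _; rewrite coef_map.
rewrite exprMn exprSr -mulrA qx0 mulrN mulr_sumr -sumrN; apply: eq_bigr => i _.
have le_id : (i <= d)%N by rewrite -ltnS.
have -> : b%:~R ^+ d = b%:~R ^+ (d - i) * b%:~R ^+ i :> R.
  by rewrite -exprD subnK.
rewrite rmorphN rmorphM rmorphXn mulNr exprMn /=; congr (- _).
by rewrite mulrCA !mulrA.
Qed.

End IntegerAction.

(** * Monomials in algebraic numbers are well separated *)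

Section Monomials.

Variables (R : realFieldType) (I : finType) (r : I -> R).

(** The monomial with exponents [k] in the numbers [r i]. *)
Definition mono (k : I -> nat) : R := \prod_i r i ^+ k i.

Lemma monoD k l : mono (fun i => k i + l i)%N = mono k * mono l.
Proof. by rewrite /mono -big_split; apply: eq_bigr => i _; rewrite exprD. Qed.

Lemma eq_mono k l : k =1 l -> mono k = mono l.
Proof. by move=> kl; apply: eq_bigr => i _; rewrite kl. Qed.

Hypothesis alg_r : forall i, algebraicOver (ratr : rat -> R) (r i).

(** Liouville inequality for monomials with exponents at most [N]. *)
Lemma mono_gap_bounded :
  exists2 K : R, 1 <= K & forall (k l : I -> nat) N,
    (forall i, (k i <= N)%N) -> (forall i, (l i <= N)%N) ->
    mono k != mono l -> 1 <= `|mono k - mono l| * K ^+ N.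
Proof.
have [a a_neq0 ar_int] :=
  fin_all_exists2 (fun i => algebraic_int_multiple (alg_r i)).
have [z|J [v [e [ve_neq0 vP]]]] :=
    @int_action_exists R [seq (a i)%:~R * r i | i : I].
  by case/mapP => i _ ->.
have [i|B arB] := @fin_all_exists I (fun=> int)
    (fun i B => int_action v ((a i)%:~R * r i) B).
  by apply: vP; apply: fintype.image_f.
have B_ge0 i : 0 <= B i := int_action_ge0 e (arB i).
pose C : int := 1 + \sum_i (`|a i| + B i).
have sum_ge0 : 0 <= \sum_i (`|a i| + B i).
  by apply: sumr_ge0 => i _; rewrite addr_ge0.
have C_ge1 : 1 <= C by rewrite lerDl.
have leC i : `|a i| + B i <= C.
  rewrite /C (bigD1 i) //= [1 + _]addrC -[leLHS]addr0 -[in leRHS]addrA lerD //.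
  by rewrite addr_ge0 // sumr_ge0 // => j _; rewrite addr_ge0.
have leaC i : `|a i| <= C by apply: le_trans (leC i); rewrite lerDl.
have leBC i : B i <= C by apply: le_trans (leC i); rewrite lerDr.
pose D := #|J|; pose G : int := C ^+ (2 * #|I|).
have G_ge1 : 1 <= G by exact: exprn_ege1.
have G_ge0 : 0 <= G by apply: le_trans G_ge1.
have GN N : (G ^+ N = \prod_(i : I) (C ^+ N * C ^+ N))%R.
  rewrite prodr_const /G -exprD -!exprM; congr (_ ^+ _).
  by rewrite addnn -mul2n mulnAC.
have leCN c N j : 0 <= c -> c <= C -> (j <= N)%N -> c ^+ j <= C ^+ N.
  move=> c_ge0 cC jN; apply: (@le_trans _ _ (C ^+ j));
    first by rewrite lerXn2r ?nnegrE // (le_trans c_ge0).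
  exact: ler_weXn2l.
pose M : int := (D`!)%:R * 3 ^+ D * G ^+ D.+1.
have M_ge1 : 1 <= M.
  by rewrite !mulr_ege1 ?exprn_ege1 // ler1n fact_gt0.
exists M%:~R; first by rewrite ler1z.
move=> k l N kN lN kl_neq.
have N_gt0 : (0 < N)%N.
  rewrite lt0n; apply: contraNneq kl_neq => N0; apply/eqP/eq_mono => i.
  by move: (kN i) (lN i); rewrite N0 !leqn0 => /eqP -> /eqP ->.
(* Multiplied by these powers of the [a i], monomials act integrally; the same
   integer factor [P] serves [mono k] and [mono l]. *)
have actP (p q : I -> nat) : (forall i, p i <= N)%N -> (forall i, q i <= N)%N ->
    int_action v (\prod_i (a i)%:~R ^+ (p i + q i) * mono p) (G ^+ N).
  move=> pN qN; rewrite /mono -big_split /=.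
  apply: (@int_action_le _ _ _ _ (\prod_i (`|a i| ^+ q i * B i ^+ p i))).
    rewrite GN; apply: ler_prod => i _.
    by rewrite mulr_ge0 ?exprn_ge0 ?ler_pM ?exprn_ge0 ?leCN.
  rewrite (eq_bigr (fun i => (a i)%:~R ^+ q i * ((a i)%:~R * r i) ^+ p i));
    last first.
    by move=> i _; rewrite exprMn exprD; ring.
  apply: int_action_prod => i; apply: int_actionM; last exact: int_actionX.
  by apply: int_actionX; exact: int_action_int.
set P : R := \prod_i (a i)%:~R ^+ (k i + l i).
have P_neq0 : P != 0.
  by apply/prodf_neq0 => i _; rewrite expf_neq0 // intr_eq0.
have leP : `|P| <= (G ^+ N)%:~R.
  rewrite normr_prod GN rmorph_prod; apply: ler_prod => i _.
  rewrite normr_ge0 /= -rmorphXn -intr_norm ler_int normrX exprD.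
  by rewrite ler_pM ?exprn_ge0 ?leCN.
have zB : int_action v (P * (mono k - mono l)) (G ^+ N + G ^+ N).
  rewrite mulrBr; apply: int_actionB; first exact: actP.
  rewrite /P (eq_bigr (fun i => (a i)%:~R ^+ (l i + k i))); first exact: actP.
  by move=> i _; rewrite addnC.
have := int_action_lower_bound ve_neq0 zB.
rewrite mulf_neq0 ?subr_eq0 // => /(_ isT) /le_trans -> //.
rewrite normrM [ `|P| * _]mulrC -mulrA ler_wpM2l //.
apply: le_trans (_ : (G ^+ N)%:~R * _ <= _).
  apply: ler_wpM2r leP; rewrite ler0z mulr_ge0 // exprn_ge0 // addr_ge0 //.
  by rewrite addr_ge0 // exprn_ge0.
rewrite -rmorphM -rmorphXn ler_int.
have GN_ge1 : 1 <= G ^+ N by exact: exprn_ege1.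
apply: (@le_trans _ _ (G ^+ N * ((D`!)%:R * (3 * G ^+ N) ^+ D))).
  rewrite ler_wpM2l ?(le_trans ler01) // ler_wpM2l // lerXn2r ?nnegrE; lia.
have -> : G ^+ N * ((D`!)%:R * (3 * G ^+ N) ^+ D) =
    ((D`!)%:R * 3 ^+ D) * (G ^+ D.+1) ^+ N.
  rewrite -[in RHS]exprM [(D.+1 * N)%N]mulnC [in RHS]exprM exprMn exprS; ring.
rewrite /M [in leRHS]exprMn ler_wpM2r ?exprn_ge0 //.
  exact: le_trans C_ge1.
by apply: ler_eXnr => //; rewrite mulr_ege1 ?exprn_ege1 // ler1n fact_gt0.
Qed.

Hypothesis r_neq0 : forall i, r i != 0.

Lemma mono_neq0 k : mono k != 0.
Proof. by apply/prodf_neq0 => i _; rewrite expf_neq0. Qed.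

(** Liouville inequality relative to the size of the monomials: dividing out
    the common factor leaves exponents at most [w]. *)
Lemma mono_gap :
  exists2 K : R, 1 <= K & forall (k l : I -> nat) w,
    (forall i, (k i <= l i + w)%N) -> (forall i, (l i <= k i + w)%N) ->
    mono k != mono l -> `|mono k| <= `|mono k - mono l| * K ^+ w.
Proof.
have [K K_ge1 gapK] := mono_gap_bounded.
pose C : R := \prod_i (1 + `|r i|).
have C_ge1 : 1 <= C.
  apply: (big_ind (fun x : R => 1 <= x)) => // [x y|i _]; last by rewrite lerDl.
  exact: mulr_ege1.
exists (K * C) => [|k l w kl lk kl_neq]; first exact: mulr_ege1.
pose c i := minn (k i) (l i).
have kE : mono k = mono c * mono (fun i => k i - c i)%N.
  by rewrite -monoD; apply: eq_mono => i; rewrite subnKC // geq_minl.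
have lE : mono l = mono c * mono (fun i => l i - c i)%N.
  by rewrite -monoD; apply: eq_mono => i; rewrite subnKC // geq_minr.
move: kl_neq; rewrite kE lE (inj_eq (mulfI (mono_neq0 _))) => kl_neq.
rewrite -mulrBr !normrM -mulrA ler_wpM2l //.
have bnd : `|mono (fun i => k i - c i)%N| <= C ^+ w.
  rewrite normr_prod -prodrXl; apply: ler_prod => i _;
    rewrite normr_ge0 normrX /=.
  apply: (@le_trans _ _ ((1 + `|r i|) ^+ (k i - c i))).
    by apply: lerXn2r; rewrite ?nnegrE ?addr_ge0 // lerDr.
  by apply: ler_weXn2l; [rewrite lerDl | have := kl i; rewrite /c; lia].
apply: le_trans bnd _; rewrite exprMn mulrA -[leLHS]mul1r ler_wpM2r //.
  by rewrite exprn_ge0 // (le_trans ler01).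
apply: gapK => // i; rewrite /c; have := kl i; have := lk i; lia.
Qed.

End Monomials.

(** * Monomials in a short interval *)

Lemma bernoulli_le (R : realFieldType) (x : R) (n : nat) : 1 <= x ->
  1 + n%:R * (x - 1) <= x ^+ n.
Proof.
move=> x_ge1; elim: n => [|n IHn]; first by rewrite mul0r addr0 expr0.
rewrite exprS; apply: (@le_trans _ _ (x * (1 + n%:R * (x - 1)))).
  have : 0 <= n%:R * (x - 1) ^+ 2 :> R by rewrite mulr_ge0 ?sqr_ge0.
  rewrite -natr1.
  nra.
by rewrite ler_wpM2l // (le_trans ler01).
Qed.

Section Growth.

Variables (R : realType) (rho : R).
Hypothesis rho_gt1 : 1 < rho.

Lemma exists_expn_gt (Y : R) : exists n, Y < rho ^+ n.
Proof.
have [Y_le0|Y_gt0] := leP Y 0.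
  by exists 0%N; rewrite expr0 (le_lt_trans Y_le0).
have rho1 : 0 < rho - 1 by rewrite subr_gt0.
have := archi_boundP (ltW (divr_gt0 Y_gt0 rho1)); set n := Num.bound _ => Yn.
exists n; apply: lt_le_trans (bernoulli_le n (ltW rho_gt1));
  rewrite ltr_pdivrMr // in Yn.
by rewrite (lt_trans Yn) // ltrDr.
Qed.

Lemma exists_expn_floor (Y : R) : 1 <= Y ->
  exists n, rho ^+ n <= Y /\ Y < rho ^+ n.+1.
Proof.
move=> Y_ge1; have [[|n] nP minn] := ex_minnP (exists_expn_gt Y).
  by move: nP; rewrite expr0 ltNge Y_ge1.
exists n; split=> //; rewrite leNgt; apply/negP => /minn.
by rewrite ltnn.
Qed.

Lemma expn_floor_le n p (Y : R) :
  rho ^+ p <= Y -> Y < rho ^+ n.+1 -> (p <= n)%N.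
Proof.
move=> le_pY lt_Yn; have := le_lt_trans le_pY lt_Yn.
by rewrite ltr_eXn2l.
Qed.

(** A power of the logarithm is bounded by any positive power, up to a
    constant factor. *)
Lemma poly_le_powR (m : nat) (alpha : R) : 0 < alpha ->
  exists2 C : R, 0 < C & forall n t,
    rho ^+ n <= t -> n.+1%:R ^+ m <= C * t `^ alpha.
Proof.
move=> alpha_gt0.
have rho_gt0 : 0 < rho by apply: lt_trans rho_gt1.
pose gamma := rho `^ (alpha / m.+1%:R).
have gammaE : gamma ^+ m.+1 = rho `^ alpha.
  by rewrite -powR_mulrn ?powR_ge0 // -powRrM divfK.
have gamma_gt1 : 1 < gamma.
  have <- : 1 `^ (alpha / m.+1%:R) = 1 :> R by rewrite powR1.
  by rewrite gt0_ltr_powR ?nnegrE ?divr_gt0 // ltW.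
pose C1 := 1 + (gamma - 1)^-1.
have g1 : 0 < gamma - 1 by rewrite subr_gt0.
have C1_gt0 : 0 < C1 by rewrite addr_gt0 ?invr_gt0.
exists (C1 ^+ m); first by rewrite exprn_gt0.
move=> n t le_nt.
have t_gt0 : 0 < t by apply: lt_le_trans le_nt; rewrite exprn_gt0.
have linear : n.+1%:R <= C1 * gamma ^+ n.
  have := bernoulli_le n (ltW gamma_gt1).
  set G := gamma ^+ n => leG; have G_ge1 : 1 <= G by rewrite exprn_ege1 // ltW.
  rewrite mulrDl mul1r -nat1r lerD // mulrC ler_pdivlMr //.
  by apply: le_trans leG; rewrite lerDr.
apply: (@le_trans _ _ ((C1 * gamma ^+ n) ^+ m)).
  by apply: lerXn2r; rewrite ?nnegrE // (le_trans _ linear).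
rewrite exprMn; apply: ler_wpM2l; first by rewrite exprn_ge0 // ltW.
apply: (@le_trans _ _ (rho `^ alpha ^+ n)).
  rewrite -gammaE -!exprM [(n * m)%N]mulnC; apply: ler_weXn2l; first exact: ltW.
  by rewrite leq_mul2r leqnSn orbT.
rewrite -powR_mulrn ?powR_ge0 // powRAC powR_mulrn ?(ltW rho_gt0) //.
by apply: ge0_ler_powR; rewrite ?nnegrE ?exprn_ge0 // ltW.
Qed.

End Growth.

Lemma seq_argmax (R : realType) (T : eqType) (f : T -> R) (s : seq T) :
  s != [::] ->
  exists2 y0, y0 \in s & forall y, y \in s -> f y <= f y0.
Proof.
elim: s => // x s IHs _; have [->|s_neq0] := eqVneq s [::].
  by exists x; rewrite ?mem_head // => y; rewrite inE => /eqP ->.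
have [y0 y0s y0max] := IHs s_neq0; have [le_xy|lt_yx] := leP (f x) (f y0).
  exists y0; first by rewrite inE y0s orbT.
  by move=> y; rewrite inE => /predU1P[->|/y0max].
exists x; first by rewrite mem_head.
move=> y; rewrite inE => /predU1P[->//|/y0max le_yy0].
exact: le_trans le_yy0 (ltW lt_yx).
Qed.

(** Pigeonhole principle for integer points [kappa y] sorted into boxes of
    side [w]. *)
Lemma box_pigeonhole (T : eqType) (I : finType) (kappa : T -> I -> nat)
    (w q : nat) (s : seq T) :
  uniq s -> (forall y i, y \in s -> (kappa y i %/ w <= q)%N) ->
  (size s <= q.+1 ^ #|I|)%N \/
  exists y y', [/\ y \in s, y' \in s, y != y' &
    forall i, kappa y i %/ w = kappa y' i %/ w]%N.
Proof.
move=> s_uniq le_q.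
pose box y : {ffun I -> 'I_q.+1} := [ffun i => inord (kappa y i %/ w)].
have [inj_box|] := pselect {in s &, injective box}.
  left; rewrite -[q.+1]card_ord -card_ffun -(size_map box).
  rewrite -(card_uniqP _) ?max_card //.
  by rewrite map_inj_in_uniq.
move=> not_inj; right; apply: contrapT => no_pair;
  apply: not_inj => y y' ys y's eq_box.
apply/eqP/negPn/negP => neq_yy'; apply: no_pair; exists y, y'; split => // i.
have /(congr1 val) := congr1 (fun g : {ffun I -> 'I_q.+1} => g i) eq_box.
by rewrite !ffunE /= !inordK // ltnS le_q.
Qed.

Section Cluster.

Variables (R : realType) (I : finType) (r : I -> R) (rho : R).
Hypotheses (rho_gt1 : 1 < rho) (rho_le : forall i, rho <= `|r i|).

Lemma mono_norm_ge (k : I -> nat) i : rho ^+ k i <= `|mono r k|.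
Proof.
rewrite /mono (bigD1 i) //= normrM normrX normr_prod -[leLHS]mulr1.
apply: ler_pM => //; first by rewrite exprn_ge0 // (le_trans ler01) // ltW.
  by apply: lerXn2r; rewrite ?nnegrE // (le_trans ler01) // ltW.
apply: (big_ind (fun x : R => 1 <= x)) => // [x y|j _]; first exact: mulr_ege1.
by rewrite normrX exprn_ege1 // (le_trans (ltW rho_gt1)).
Qed.

Hypothesis alg_r : forall i, algebraicOver (ratr : rat -> R) (r i).

(** The number of monomials in a set of diameter at most [H] is either at most
    a constant, or at most polylogarithmic in [H]. *)
Lemma mono_cluster : exists K0 : nat, forall (s : seq R) (H : R),
  uniq s -> (forall y, y \in s -> exists k, y = mono r k) -> 1 <= H ->
  (forall y y', y \in s -> y' \in s -> `|y - y'| <= H) ->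
  (size s <= K0)%N \/
  exists n, rho ^+ n <= 4 * H ^+ 2 /\ (size s <= n.+1 ^ #|I|)%N.
Proof.
have rho_gt0 : 0 < rho by apply: lt_trans rho_gt1.
have r_neq0 i : r i != 0 by rewrite -normr_gt0 (lt_le_trans rho_gt0).
have [K K_ge1 gapK] := mono_gap alg_r r_neq0.
have [c0 /ltW leKc0] := exists_expn_gt rho_gt1 K.
pose c := c0.+1; have leKc : K <= rho ^+ c.
  by rewrite (le_trans leKc0) // ler_weXn2l // ltW.
exists ((4 * c).+1 ^ #|I|)%N => s H s_uniq s_mono H_ge1 s_near.
have [->|s_neq0] := eqVneq s [::]; first by left.
have [y0 y0s y0max] := seq_argmax (fun y : R => `|y|) s_neq0.
have /choice[kappa kappaP] : forall y, exists k, y \in s -> y = mono r k.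
  move=> y; have [/s_mono[k yk]|] := boolP (y \in s); first by exists k.
  by exists (fun=> 0%N).
have y0_ge1 : 1 <= `|y0|.
  rewrite (kappaP _ y0s) normr_prod.
  apply: (big_ind (fun x : R => 1 <= x)) => // [x y|j _];
    first exact: mulr_ege1.
  by rewrite normrX exprn_ege1 // (le_trans (ltW rho_gt1)).
have [n [le_ny0 lt_y0n]] := exists_expn_floor rho_gt1 y0_ge1.
have kappa_le y i : y \in s -> (kappa y i <= n)%N.
  move=> ys; apply: (expn_floor_le rho_gt1 _ lt_y0n).
  by apply: le_trans (y0max _ ys); rewrite {2}(kappaP y ys) mono_norm_ge.
have size_n : (size s <= n.+1 ^ #|I|)%N.
  have [y i ys||[y [y' [ys y's /eqP neq_yy' eq_k]]]] //= :=
    @box_pigeonhole _ _ kappa 1 n s s_uniq.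
    by rewrite divn1 kappa_le.
  case: neq_yy'; rewrite (kappaP y ys) (kappaP y' y's).
  by apply: eq_mono => i; have := eq_k i; rewrite !divn1.
have H_ge0 : 0 <= H by apply: le_trans H_ge1.
have HH : H <= H ^+ 2 by rewrite expr2 ler_peMl.
(* If [|y0|] is at most twice the diameter, all the exponents are already
   logarithmic in [H]; otherwise all the monomials in [s] have size comparable
   with [|y0|]. *)
have [le_y0H|lt_Hy0] := leP `|y0| (2 * H).
  right; exists n; split => //; apply: (le_trans le_ny0);
    apply: (le_trans le_y0H).
  by nra.
(* With this width the Liouville factor [K ^+ w] is at most the square root of
   [rho ^+ n], while, for [w] positive, at most [4 * c] + 1 boxes are needed
   per coordinate. *)
pose w := (n %/ (2 * c))%N.
have lt_nw : (n < w.+1 * (2 * c))%N by apply: ltn_ceil; rewrite muln_gt0.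
have le_2c4c : (2 * c <= 4 * c)%N by rewrite leq_mul2r orbT.
have [w_eq0|w_gt0] := posnP w.
  left; apply: (leq_trans size_n).
  have [->|I_gt0] := posnP #|I|; first by rewrite !expn0.
  rewrite leq_exp2r // ltnS; apply: leq_trans le_2c4c.
  by move: lt_nw; rewrite w_eq0 mul1n => /ltnW.
have nw : (n %/ w <= 4 * c)%N.
  rewrite -ltnS ltn_divLR //; apply: (leq_trans lt_nw).
  apply: (@leq_trans (2 * w * (2 * c))).
    by apply: leq_mul; rewrite // mul2n -addnn -addn1 leq_add2l.
  by rewrite mulnACA [(w * c)%N]mulnC mulnA leq_mul2r leqnSn orbT.
have [y i ys||[y [y' [ys y's neq_yy' eq_k]]]] :=
  @box_pigeonhole _ _ kappa w (4 * c) s s_uniq.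
- by apply: leq_trans nw; apply: leq_div2r; exact: kappa_le.
- by left.
right; exists n; split=> //.
have near_k z z' i :
    (kappa z i %/ w = kappa z' i %/ w)%N -> (kappa z i <= kappa z' i + w)%N.
  move=> eq_zz'; rewrite (divn_eq (kappa z i) w) (divn_eq (kappa z' i) w)
    eq_zz'.
  by rewrite -addnA leq_add2l (leq_trans (ltnW (ltn_pmod _ w_gt0))) // leq_addl.
have := gapK (kappa y) (kappa y') w (fun i => near_k _ _ i (eq_k i))
  (fun i => near_k _ _ i (esym (eq_k i))).
rewrite -(kappaP y ys) -(kappaP y' y's) => /(_ neq_yy') le_y.
pose X := rho ^+ (c * w).
have X_gt0 : 0 < X by rewrite exprn_gt0.
have XX : X ^+ 2 <= rho ^+ n.
  rewrite -exprM; apply: ler_weXn2l; first exact: ltW.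
  apply: leq_trans (leq_divM n (2 * c)); rewrite -/w.
  by have -> : (c * w * 2 = w * (2 * c))%N by ring.
have {}le_y : `|y| <= H * X.
  apply: (le_trans le_y); apply: ler_pM => //;
    first by rewrite exprn_ge0 // (le_trans ler01).
    exact: s_near.
  by rewrite /X exprM; apply: lerXn2r;
    rewrite ?nnegrE ?exprn_ge0 ?(le_trans ler01) // ltW.
have y_ge : `|y0| <= 2 * `|y|.
  by have := s_near y0 y y0s ys; have := lerB_dist y0 y; lra.
have le_n : rho ^+ n <= 2 * H * X by apply: le_trans le_ny0 _; lra.
have N_gt0 : 0 < rho ^+ n by rewrite exprn_gt0.
set N := rho ^+ n in XX le_n N_gt0 *.
rewrite -(ler_pM2r N_gt0).
apply: (@le_trans _ _ ((2 * H * X) ^+ 2)).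
  by rewrite -expr2; apply: lerXn2r;
    rewrite ?nnegrE ?(ltW N_gt0) // !mulr_ge0 // ltW.
have -> : (2 * H * X) ^+ 2 = 4 * H ^+ 2 * X ^+ 2 by ring.
by apply: ler_wpM2l => //; rewrite mulr_ge0 // sqr_ge0.
Qed.

End Cluster.

(** * Counting sets and submultiplicative functions *)

Section Cardinals.
Local Open Scope classical_set_scope.

Lemma finite_sub_range (J : finType) (T : choiceType) (f : J -> T) (A : set T) :
  A `<=` range f -> finite_set A.
Proof.
move=> Af; apply: sub_finite_set Af _; apply: finite_image.
exact: finite_finset.
Qed.

Lemma card_sub_range (J : finType) (T : choiceType) (f : J -> T) (A : set T) :
  A `<=` range f -> (#|` fset_set A| <= #|J|)%N.
Proof.
move=> Af; have finA := finite_sub_range Af.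
rewrite cardE -(size_map f); apply: uniq_leq_size => [|x];
  first exact: fset_uniq.
rewrite in_fset_set // inE => /Af[j _ <-].
by apply: map_f; rewrite mem_enum.
Qed.

Lemma card_ge_inj (J : finType) (T : choiceType) (f : J -> T) (A : set T) :
  finite_set A -> injective f -> (forall j, A (f j)) ->
  (#|J| <= #|` fset_set A|)%N.
Proof.
move=> finA f_inj Af; rewrite cardE -(size_map f).
apply: uniq_leq_size => [|x]; first by rewrite map_inj_uniq ?enum_uniq.
by case/mapP => j _ ->; rewrite in_fset_set // inE.
Qed.

(** The real bound [K] need only be checked on finite subsets, listed without
    repetition. *)
Lemma counting_le (R : realType) (T : choiceType) (A : set T) (K : R) :
  (forall s : seq T,
    uniq s -> (forall x, x \in s -> A x) -> (size s)%:R <= K) ->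
  (counting A <= K%:E)%E.
Proof.
move=> sizeK; rewrite /counting; case: ifPn => [/asboolP finA|/asboolP infA].
  rewrite lee_fin; apply: sizeK => [|x]; first exact: fset_uniq.
  by rewrite in_fset_set // inE.
have K_ge0 : 0 <= K by exact: (sizeK [::]).
have [B BA leKB] := infinite_set_fset (Num.bound K) infA.
have := sizeK B (fset_uniq _) (fun x xB => BA x xB).
by rewrite leNgt (lt_le_trans (archi_boundP K_ge0)) // ler_nat.
Qed.

End Cardinals.

Lemma le_mul_ln (R : realType) (x e t : R) :
  0 < e -> 0 < t -> expR (x / e) <= t -> x <= e * ln t.
Proof.
move=> e_gt0 t_gt0 le_t; rewrite mulrC -ler_pdivrMr //.
by rewrite -[leLHS]expRK ler_ln ?posrE ?expR_gt0.
Qed.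

Section Fekete.
Local Open Scope classical_set_scope.

Variables (R : realType) (M : R -> R) (K : R).
Hypotheses (K_ge1 : 1 <= K) (M_ge1 : forall t, 1 <= M t).
Hypothesis M_homo : forall s t, s <= t -> M s <= M t.
Hypothesis M_submul : forall s t,
  1 <= s -> 1 <= t -> M (s * t) <= K * (M s * M t).

Lemma submul_expn t n : 1 <= t -> K * M (t ^+ n.+1) <= (K * M t) ^+ n.+1.
Proof.
move=> t_ge1; elim: n => [|n IHn]; first by rewrite !expr1.
have K_ge0 : 0 <= K by apply: le_trans K_ge1.
have M_ge0 s : 0 <= M s by apply: le_trans (M_ge1 s).
rewrite exprS [leRHS]exprS.
apply: (@le_trans _ _ (K * (K * (M t * M (t ^+ n.+1))))).
  by rewrite ler_wpM2l // M_submul // exprn_ege1.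
have -> : K * (K * (M t * M (t ^+ n.+1))) = K * M t * (K * M (t ^+ n.+1)).
  by ring.
by rewrite ler_wpM2l // mulr_ge0.
Qed.

(** Fekete's lemma for functions of a continuous multiplicative variable.  The
    limit is the infimum of [ln (K * M t) / ln t] over [t > 1]. *)
Lemma fekete_cvg : exists c : R, (ln (M t) / ln t) @[t --> +oo] --> c.
Proof.
have K_gt0 : 0 < K by apply: lt_le_trans K_ge1.
have M_gt0 t : 0 < M t by apply: lt_le_trans (M_ge1 t).
have KM_gt0 t : 0 < K * M t by rewrite mulr_gt0.
pose u t := ln (K * M t).
have u_ge0 t : 0 <= u t by rewrite ln_ge0 // mulr_ege1.
pose S := [set u t / ln t | t in [set t | 1 < t]].
have S_ge0 : lbound S 0.
  by move=> _ [t t_gt1 <-]; rewrite divr_ge0 // ltW // ln_gt0.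
have infS : has_inf S.
  split; last by exists 0.
  by exists (u 2 / ln 2), 2 => //=; rewrite ltr1n.
pose c := inf S.
have c_ge0 : 0 <= c by apply: lb_le_inf => //; case: infS.
have c_le t : 1 < t -> c * ln t <= u t.
  move=> t_gt1; rewrite -ler_pdivlMr ?ln_gt0 //; apply: ge_inf;
    first by case: infS.
  by exists t.
exists c; apply/cvgrPdist_le => eps eps_gt0.
have e2 : 0 < eps / 2 by rewrite divr_gt0.
(* [T] nearly realizes the infimum; other arguments are compared with its
   powers. *)
have [_ [T /= T_gt1 <-] uT] := inf_adherent e2 infS.
rewrite ltr_pdivrMr ?ln_gt0 // -/c in uT.
near=> t.
have t_gt1 : 1 < t by near: t; apply: nbhs_pinfty_gt; exact: num_real.
have t_gt0 : 0 < t by apply: lt_trans t_gt1.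
have lt_gt0 : 0 < ln t by rewrite ln_gt0.
have uE : u t = ln K + ln (M t) by rewrite /u lnM ?posrE.
have leK : ln K <= eps / 2 * ln t.
  by apply: le_mul_ln => //; near: t; apply: nbhs_pinfty_ge; exact: num_real.
have leT : (c + eps / 2) * ln T <= eps / 2 * ln t.
  by apply: le_mul_ln => //; near: t; apply: nbhs_pinfty_ge; exact: num_real.
have [n [le_nt lt_tn]] := exists_expn_floor T_gt1 (ltW t_gt1).
have T_gt0 : 0 < T by apply: lt_trans T_gt1.
have lnT_gt0 : 0 < ln T by rewrite ln_gt0.
have ut_le : u t <= n.+1%:R * u T.
  rewrite mulr_natl -lnXn // ler_ln ?posrE ?exprn_gt0 //.
  apply: le_trans (submul_expn n (ltW T_gt1)).
  by rewrite ler_pM2l // M_homo // ltW.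
have lnt_ge : n%:R * ln T <= ln t.
  by rewrite mulr_natl -lnXn // ler_ln ?posrE ?exprn_gt0.
have ut_le2 : u t <= (c + eps / 2) * (ln t + ln T).
  apply: (le_trans ut_le); rewrite -natr1.
  have n1_ge0 : 0 <= n%:R :> R by [].
  have := ltW uT; set x := ln T in lnT_gt0 lnt_ge *; set y := u T.
  have ce : 0 <= c + eps / 2 by rewrite addr_ge0 // ltW.
  move=> yx; apply: (@le_trans _ _ ((n%:R + 1) * ((c + eps / 2) * x))).
    by rewrite ler_wpM2l ?addr_ge0.
  rewrite mulrCA ler_wpM2l // mulrDl mul1r lerD2r //.
have ct := c_le t t_gt1.
rewrite ler_norml; apply/andP; split.
  rewrite lerNl opprB lerBlDr ler_pdivrMr //.
  by rewrite mulrDr in ut_le2; have := ln_ge0 K_ge1; lra.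
rewrite lerBlDr -lerBlDl ler_pdivlMr //; lra.
Unshelve. all: by end_near.
Qed.

End Fekete.

(** * Words, maps and growth balls *)

Section AffineMaps.
Variable R : realType.

Lemma affine_map_inj (c d c' d' : R) :
  affine_map c d = affine_map c' d' -> c = c' /\ d = d'.
Proof.
move=> eq_cd; have eq_x x : c * x + d = c' * x + d' :=
  congr1 (fun g => g x) eq_cd.
have dd' : d = d' by have := eq_x 0; rewrite !mulr0 !add0r.
by split=> //; have := eq_x 1; rewrite !mulr1 dd' => /addIr.
Qed.

Lemma affine_map_comp (c d c' d' : R) :
  affine_map c d \o affine_map c' d' = affine_map (c * c') (c * d' + d).
Proof. by apply/funext => x; rewrite /affine_map /=; ring. Qed.

End AffineMaps.

Section Words.
Variables (I T : Type) (F : I -> T -> T).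

(** The composition of the maps named by the letters of [w], the first letter
    being applied last; the empty word gives the identity. *)
Definition word_map (w : seq I) : T -> T := foldr (fun i g => F i \o g) id w.

Lemma word_map_cat u v : word_map (u ++ v) = word_map u \o word_map v.
Proof. by elim: u => //= i u ->. Qed.

Lemma gen_semigroupP (g : T -> T) :
  gen_semigroup F g <-> exists i w, g = word_map (i :: w).
Proof.
split=> [|[i [w ->]] {g}]; last first.
  elim: w i => [|j w IHw] i /=; first exact: gen_semigroup_gen.
  by apply: gen_semigroup_comp; [exact: gen_semigroup_gen | exact: IHw].
elim=> [i|_ _ _ [i [u ->]] _ [j [v ->]]]; first by exists i, [::].
by exists i, (u ++ j :: v); rewrite -word_map_cat.
Qed.

End Words.

Section System.
Local Open Scope classical_set_scope.

Variables (R : realType) (m : nat) (r b : 'I_m -> R) (rho : R).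
Hypotheses (rho_gt1 : 1 < rho) (rho_le : forall i, rho <= `|r i|).

Local Notation F := (affine_system r b).
Local Notation N t := #|` fset_set (growth_ball F t)|.

(** The linear coefficient of [word_map F w]. *)
Definition word_slope (w : seq 'I_m) : R := \prod_(i <- w) r i.

Lemma word_map_affine w : exists d, word_map F w = affine_map (word_slope w) d.
Proof.
elim: w => [|i w [d IHw]].
  by exists 0; apply/funext => x;
    rewrite /affine_map /word_slope big_nil mul1r addr0.
by exists (r i * d + b i);
  rewrite /= IHw /affine_system affine_map_comp /word_slope big_cons.
Qed.

Lemma word_slope_ge w : rho ^+ size w <= `|word_slope w|.
Proof.
elim: w => [|i w IHw]; first by rewrite /word_slope big_nil normr1.
rewrite /word_slope big_cons normrM exprS ler_pM //.
  by rewrite (le_trans ler01) // ltW.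
by rewrite exprn_ge0 // (le_trans ler01) // ltW.
Qed.

Lemma growth_ballP t g :
  growth_ball F t g <-> exists i w,
    g = word_map F (i :: w) /\ `|word_slope (i :: w)| <= t.
Proof.
split=> [[/gen_semigroupP[i [w gE]] [c [d [gcd le_ct]]]]|[i [w [gE le_t]]]].
  exists i, w; split=> //; have [d' wE] := word_map_affine (i :: w).
  have [<- _] : c = word_slope (i :: w) /\ d = d' by apply: affine_map_inj;
    rewrite -gcd gE.
  by [].
split; first by apply/gen_semigroupP; exists i, w.
have [d' wE] := word_map_affine (i :: w).
by exists (word_slope (i :: w)), d'; rewrite gE.
Qed.

Lemma growth_ball_finite t : finite_set (growth_ball F t).
Proof.
have [n lt_tn] := exists_expn_gt rho_gt1 t.
pose f (w : n.-bseq 'I_m) := word_map F w.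
apply: (@finite_sub_range _ _ f) => g /growth_ballP[i [w [-> le_t]]].
have size_w : (size (i :: w) <= n)%N.
  have := le_lt_trans (word_slope_ge (i :: w)) (le_lt_trans le_t lt_tn).
  by rewrite ltr_eXn2l // => /ltnW.
by exists (Bseq size_w).
Qed.

Lemma growth_ball_homo s t : s <= t -> (N s <= N t)%N.
Proof.
move=> le_st; apply: fsubset_leq_card.
rewrite -fset_set_sub; try exact: growth_ball_finite.
move=> g [gF [c [d [gcd le_cs]]]]; split=> //; exists c, d; split=> //.
exact: le_trans le_st.
Qed.

(** The pivot letter [j] is the one at which the slope of the prefix first
    exceeds [s], or the last letter of the word if this never happens. *)
Lemma word_split s t i w :
  1 <= s -> 1 <= t -> `|word_slope (i :: w)| <= s * t ->
  exists u j v, [/\ i :: w = u ++ j :: v,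
    `|word_slope u| <= s & `|word_slope v| <= t].
Proof.
elim: w s i => [|j w IHw] s i s_ge1 t_ge1 le_st.
  by exists [::], i, [::]; rewrite /word_slope !big_nil !normr1.
have ri_gt0 : 0 < `|r i|.
  by apply: lt_le_trans (rho_le i); apply: lt_trans rho_gt1.
rewrite /word_slope big_cons normrM -/(word_slope _) in le_st.
have [le_rs|lt_sr] := leP `|r i| s; last first.
  exists [::], i, (j :: w); split=> //;
    first by rewrite /word_slope big_nil normr1.
  rewrite -(ler_pM2l ri_gt0); apply: (le_trans le_st).
  by rewrite ler_wpM2r ?(le_trans ler01) // ltW.
have [|||u [k [v [-> le_u le_v]]]] := IHw (s / `|r i|) j => //.
- by rewrite ler_pdivlMr ?mul1r.
- by rewrite mulrAC ler_pdivlMr // mulrC.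
exists (i :: u), k, v; split=> //.
by rewrite /word_slope big_cons normrM mulrC -ler_pdivlMr.
Qed.

(** By [word_split]; a prefix or a suffix may be empty, which accounts for the
    two successors. *)
Lemma growth_ball_submul s t : 1 <= s -> 1 <= t ->
  (N (s * t) <= m * (N s).+1 * (N t).+1)%N.
Proof.
move=> s_ge1 t_ge1.
pose Bs := fset_set (growth_ball F s); pose Bt := fset_set (growth_ball F t).
pose J := ('I_m * option Bs * option Bt)%type.
pose val1 (X : {fset (R -> R)}) (o : option X) : R -> R :=
  if o is Some g then fsval g else id.
pose f (p : J) : R -> R := val1 _ p.1.2 \o F p.1.1 \o val1 _ p.2.
have -> : (m * (N s).+1 * (N t).+1)%N = #|{: J}|.
  by rewrite !card_prod card_ord !card_option -!cardfE.
apply: (@card_sub_range _ _ f) => g /growth_ballP[i [w [-> le_st]]].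
have [u [j [v [-> le_u le_v]]]] := word_split s_ge1 t_ge1 le_st.
have lift_word x w' : `|word_slope w'| <= x ->
    exists o : option (fset_set (growth_ball F x)), val1 _ o = word_map F w'.
  case: w' => [|k w'] le_x; first by exists None.
  have w'x : word_map F (k :: w') \in fset_set (growth_ball F x).
    rewrite in_fset_set ?inE; last exact: growth_ball_finite.
    by apply/growth_ballP; exists k, w'.
  by exists (Some [` w'x]%fset).
have [ou uE] := lift_word s u le_u; have [ov vE] := lift_word t v le_v.
by exists (j, ou, ov); rewrite // /f /= uE vE word_map_cat.
Qed.

Lemma growth_ratio_cvg : (0 < m)%N ->
  exists c : R, (ln ((N t)%:R : R) / ln t) @[t --> +oo] --> c.
Proof.
move=> m_gt0.
(* As [ln 0 = 0 = ln 1], empty balls may be counted as one element. *)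
pose M t : R := (maxn 1 (N t))%:R.
have -> : (fun t => ln ((N t)%:R : R) / ln t) = (fun t => ln (M t) / ln t).
  apply/funext => t; rewrite /M; case: (N t) => [|n];
    last by rewrite maxnE add1n subn1.
  by rewrite ln0 // ln1.
apply: (@fekete_cvg R M (m%:R * 4)) => [|t|s t le_st|s t s_ge1 t_ge1].
- by rewrite mulr_ege1 ?ler1n.
- by rewrite ler1n leq_maxl.
- by rewrite ler_nat; move: (growth_ball_homo le_st); lia.
rewrite -[4]/(4%:R) -!natrM ler_nat; have := growth_ball_submul s_ge1 t_ge1.
set x := N _; set y := N s; set z := N t => le_x.
rewrite geq_max !muln_gt0 m_gt0 !leq_max /= (leq_trans le_x) //
  -!mulnA leq_mul2l.
apply/orP; right; apply: (@leq_trans ((2 * maxn 1 y) * (2 * maxn 1 z))).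
  by apply: leq_mul; lia.
by rewrite mulnACA.
Qed.

End System.

(** * Growth and orbits in the two cases *)

Section TwoMaps.
Variables (R : realFieldType) (sigma d0 d1 : R).
Hypothesis sigma_ge2 : 2 <= `|sigma|.

(** The translation part of the composition, along the word [s], of two affine
    maps of slope [sigma] and translation parts [d0] and [d1]. *)
Definition bin_sum (s : seq bool) : R :=
  foldr (fun c x => sigma * x + (if c then d0 else d1)) 0 s.

(** Distinct expansions of the same length are separated: a gap between the
    tails is at least doubled by [sigma], and the last translations added can
    undo at most half of it. *)
Lemma bin_sum_sep s s' : size s = size s' -> s != s' ->
  `|d0 - d1| <= `|bin_sum s - bin_sum s'|.
Proof.
elim: s s' => [|c s IHs] [|c' s'] //= [size_ss'] neq_ss'.
set dc := if c then _ else _; set dc' := if c' then _ else _.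
have -> : sigma * bin_sum s + dc - (sigma * bin_sum s' + dc') =
    sigma * (bin_sum s - bin_sum s') + (dc - dc') by ring.
have le_dc : `|dc - dc'| <= `|d0 - d1|.
  by rewrite /dc /dc'; case: (c) (c') => -[]; rewrite ?subrr ?normr0 // distrC.
have [eq_ss'|neq] := eqVneq s s'.
  rewrite eq_ss' subrr mulr0 add0r /dc /dc'.
  by move: neq_ss'; rewrite eq_ss'; case: (c) (c') => -[];
    rewrite ?eqxx // distrC.
have := IHs s' size_ss' neq; set D := `|_ - _| => le_D.
set x := bin_sum s - bin_sum s' in le_D *.
have := lerB_dist (sigma * x) (- (dc - dc')); rewrite opprK normrN normrM.
apply: le_trans; rewrite lerBrDr.
apply: (@le_trans _ _ (2 * D)); first by rewrite mulr_natl mulr2n lerD2l.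
by apply: ler_pM; rewrite ?normr_ge0.
Qed.

End TwoMaps.

Section System.
Local Open Scope classical_set_scope.

Variables (R : realType) (m : nat) (r b : 'I_m -> R) (rho : R).
Hypotheses (rho_gt1 : 1 < rho) (rho_le : forall i, rho <= `|r i|).

Local Notation F := (affine_system r b).
Local Notation N t := #|` fset_set (growth_ball F t)|.

Lemma word_map_nseq k i p : F i p = p ->
  word_map F (nseq k i) = affine_map (r i ^+ k) (p - r i ^+ k * p).
Proof.
rewrite /affine_system /affine_map => Fp.
have bE : b i = p - r i * p by rewrite -{1}Fp addrC addKr.
elim: k => [|k IHk].
  by apply/funext => x /=; rewrite /affine_map expr0 !mul1r subrr addr0.
by rewrite /= IHk /affine_system affine_map_comp bE exprS; congr affine_map;
  ring.
Qed.

Lemma fixed_pointE i : F i (b i / (1 - r i)) = b i / (1 - r i).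
Proof.
have ri : 1 - r i != 0.
  rewrite subr_eq0; apply/eqP => r1; have := lt_le_trans rho_gt1 (rho_le i).
  by rewrite -r1 normr1 ltxx.
by rewrite /affine_system /affine_map; field.
Qed.

(** Without a common fixed point, the balls grow at least like a power of the
    radius. *)
Lemma nondegenerate_growth : (0 < m)%N -> ~ degenerate F ->
  exists2 sigma : R, 2 <= sigma & forall n, (2 ^ n.+1 <= N (sigma ^+ n.+1))%N.
Proof.
move=> m_gt0 ndeg; pose i := Ordinal m_gt0.
pose p i := b i / (1 - r i); have pP := fixed_pointE.
have [j neq_pij] : exists j, p i != p j.
  apply: contrapT => all_eq; apply: ndeg; exists (p i) => j.
  have [->|neq] := eqVneq (p i) (p j); first exact: pP.
  by case: all_eq; exists j.
have r_gt1 k : 1 < `|r k| := lt_le_trans rho_gt1 (rho_le k).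
have [k0 lt_2r] := exists_expn_gt (r_gt1 i) 2; pose k := k0.+1.
have {}lt_2r : 2 < `|r i| ^+ k by apply: (lt_trans lt_2r); rewrite ltr_eXn2l.
(* The two maps: iterates of [F i] and [F j], composed in both orders *)
pose u := nseq k i ++ nseq k j; pose v := nseq k j ++ nseq k i.
pose x := r i ^+ k; pose y := r j ^+ k; pose sigma := x * y.
have x_ge2 : 2 <= `|x| by rewrite normrX ltW.
have y_gt1 : 1 < `|y| by rewrite normrX exprn_egt1.
pose du := x * (p j - y * p j) + (p i - x * p i).
pose dv := y * (p i - x * p i) + (p j - y * p j).
have uE : word_map F u = affine_map sigma du.
  by rewrite word_map_cat (word_map_nseq _ (pP i)) (word_map_nseq _ (pP j))
    affine_map_comp.
have vE : word_map F v = affine_map sigma dv.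
  by rewrite word_map_cat (word_map_nseq _ (pP i)) (word_map_nseq _ (pP j))
    affine_map_comp [y * x]mulrC.
have duv : du != dv.
  have neq1 (z : R) : 1 < `|z| -> 1 - z != 0.
    by move=> z_gt1; rewrite subr_eq0; apply: contraTneq z_gt1 => <-;
      rewrite normr1 ltxx.
  rewrite -subr_eq0.
  have -> : du - dv = (p i - p j) * (1 - x) * (1 - y) by rewrite /du /dv; ring.
  rewrite !mulf_neq0 ?subr_eq0 ?neq_pij //; rewrite -subr_eq0 neq1 //.
  by apply: lt_le_trans x_ge2; rewrite ltr1n.
have sigma_ge2 : 2 <= `|sigma|.
  by rewrite normrM -[2]mulr1 ler_pM // ltW.
pose code (s : seq bool) := flatten [seq if c then u else v | c <- s].
have codeE s : word_map F (code s) =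
    affine_map (sigma ^+ size s) (bin_sum sigma du dv s).
  elim: s => [|c s IHs].
    by apply/funext => z; rewrite /affine_map /= mul1r addr0.
  rewrite /code /= word_map_cat IHs exprS.
  by case: c; rewrite ?uE ?vE affine_map_comp.
exists `|sigma| => // n; rewrite -card_bool -card_tuple.
apply: (@card_ge_inj _ _ (fun s : n.+1.-tuple bool => word_map F (code s))).
- exact: growth_ball_finite rho_gt1 rho_le _.
- move=> s s' eq_code; apply/eqP/negPn/negP => neq_ss'.
  have [_ eq_sum] : sigma ^+ size s = sigma ^+ size s' /\
      bin_sum sigma du dv s = bin_sum sigma du dv s'.
    by apply: affine_map_inj; rewrite -!codeE.
  have := @bin_sum_sep _ sigma du dv sigma_ge2 s s';
    rewrite !size_tuple => /(_ erefl neq_ss').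
  by rewrite eq_sum subrr normr0 normr_le0 subr_eq0 (negPf duv).
move=> s; split.
  apply/gen_semigroupP; case/tupleP: s => c s.
  by case: c; do 2?eexists.
exists (sigma ^+ size s), (bin_sum sigma du dv s); split; first exact: codeE.
by rewrite size_tuple normrX.
Qed.

(** In the degenerate case, the map is determined by its slope. *)
Lemma degenerate_map p g : (forall i, F i p = p) -> gen_semigroup F g ->
  exists k, g = affine_map (mono r k) (p - mono r k * p).
Proof.
move=> Fp; elim=> [i|_ _ _ [k ->] _ [l ->]].
  exists (fun j => (j == i : nat)).
  have -> : mono r (fun j => (j == i : nat)) = r i.
    by rewrite /mono (bigD1 i) //= eqxx big1 ?mulr1 // => j /negPf ->.
  by have := word_map_nseq 1 (Fp i); rewrite expr1 => <-.
exists (fun i => k i + l i)%N; rewrite monoD affine_map_comp.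
by congr affine_map; ring.
Qed.

Lemma degenerate_growth_le t n : degenerate F -> t < rho ^+ n.+1 ->
  (N t <= n.+1 ^ m)%N.
Proof.
move=> [p Fp] lt_tn.
pose mk (h : {ffun 'I_m -> 'I_n.+1}) := mono r (fun i => h i : nat).
pose f h := affine_map (mk h) (p - mk h * p).
rewrite -[in leqRHS](card_ord n.+1) -[X in (_ ^ X)%N](card_ord m) -card_ffun.
apply: (@card_sub_range _ _ f) => g [/(degenerate_map Fp)[k gE] [c [d [gcd
  le_ct]]]].
have [kc _] : mono r k = c /\ p - mono r k * p = d.
  by apply: affine_map_inj; rewrite -gE gcd.
have le_kn i : (k i <= n)%N.
  apply: (expn_floor_le rho_gt1 _ lt_tn); apply: le_trans le_ct.
  by rewrite -kc; exact: mono_norm_ge rho_gt1 rho_le _ _.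
exists [ffun i => inord (k i)] => //; rewrite gE /f /mk.
suff -> : mono r (fun i => [ffun i => inord (k i)] i : 'I_n.+1) = mono r k by
  [].
by apply: eq_mono => i; rewrite ffunE inordK // ltnS.
Qed.

Lemma growth_dim_degenerate : degenerate F -> growth_dim F = 0.
Proof.
move=> deg; apply: cvg_lim; first exact: Rhausdorff.
apply/cvgrPdist_le => eps eps_gt0.
have e2 : 0 < eps / 2 by rewrite divr_gt0.
have [C C_gt0 leC] := poly_le_powR rho_gt1 m e2.
near=> t.
have t_gt1 : 1 < t by near: t; apply: nbhs_pinfty_gt; exact: num_real.
have t_gt0 : 0 < t by apply: lt_trans t_gt1.
have lnt_gt0 : 0 < ln t by rewrite ln_gt0.
have leCt : ln C <= eps / 2 * ln t.
  by apply: le_mul_ln => //; near: t; apply: nbhs_pinfty_ge; exact: num_real.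
have lnN_ge0 : 0 <= ln ((N t)%:R : R).
  case: (N t) => [|n]; first by rewrite ln0.
  by rewrite ln_ge0 // ler1n.
rewrite sub0r normrN ger0_norm; last by rewrite divr_ge0 // ltW.
rewrite ler_pdivrMr //.
have [n [le_nt lt_tn]] := exists_expn_floor rho_gt1 (ltW t_gt1).
have leN : (N t)%:R <= C * t `^ (eps / 2).
  by apply: le_trans (leC n t le_nt);
    rewrite -natrX ler_nat degenerate_growth_le.
have [N0|N_gt0] := posnP (N t).
  by rewrite N0 ln0 // mulr_ge0 // ltW.
apply: (@le_trans _ _ (ln (C * t `^ (eps / 2)))).
  by rewrite ler_ln // posrE ?ltr0n // mulr_gt0 // powR_gt0.
rewrite lnM ?posrE ?powR_gt0 // ln_powR; lra.
Unshelve. all: by end_near.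
Qed.

Lemma growth_dim_nondegenerate :
  (0 < m)%N -> ~ degenerate F -> growth_dim F != 0.
Proof.
move=> m_gt0 ndeg; apply/eqP => dim0.
have [c cvg_c] := growth_ratio_cvg b rho_gt1 rho_le m_gt0.
have c0 : c = 0 by rewrite -dim0; apply/esym/cvg_lim => //; exact: Rhausdorff.
have [sigma sigma_ge2 leN] := nondegenerate_growth m_gt0 ndeg.
have sigma_gt1 : 1 < sigma by apply: lt_le_trans sigma_ge2; rewrite ltr1n.
have ls_gt0 : 0 < ln sigma by rewrite ln_gt0.
have l2_gt0 : 0 < ln 2 :> R by rewrite ln_gt0 // ltr1n.
move/cvgrPdist_lt: cvg_c => /(_ (ln 2 / ln sigma));
  rewrite divr_gt0 // => /(_ isT).
rewrite c0 => -[M0 [_ M0P]].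
have [n0 lt_n0] := exists_expn_gt sigma_gt1 M0.
have lt_n : M0 < sigma ^+ n0.+1.
  by apply: (lt_trans lt_n0); rewrite ltr_eXn2l.
have := M0P _ lt_n; rewrite sub0r normrN => /(le_lt_trans (ler_norm _)).
have s_gt0 : 0 < sigma by apply: lt_trans sigma_gt1.
rewrite lnXn // ltr_pdivrMr ?mulrn_wgt0 // mulrnAr divfK ?gt_eqF //.
rewrite -lnXn // ltNge; case/negP.
by rewrite ler_ln ?posrE ?exprn_gt0 ?ltr0n // -?natrX ?ler_nat //
  (leq_trans _ (leN _)) // expn_gt0.
Qed.

Hypothesis alg_r : forall i, algebraicOver (ratr : rat -> R) (r i).

Lemma orbit_count_le p a alpha : (forall i, F i p = p) -> 0 < alpha ->
  exists h0 K : R, forall h x, h0 <= h ->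
    (counting (forward_orbit F a `&` [set y | (x - h <= y <= x + h)%R]) <=
      (K * h `^ alpha)%:E)%E.
Proof.
move=> Fp alpha_gt0.
have orbitP y : forward_orbit F a y -> exists k, y = p + mono r k * (a - p).
  move=> [g /(degenerate_map Fp)[k ->] <-]; exists k.
  by rewrite /affine_map; ring.
have [K0 clusterP] := mono_cluster rho_gt1 rho_le alg_r.
have a2 : 0 < alpha / 2 by rewrite divr_gt0.
have [C C_gt0 leC] := poly_le_powR rho_gt1 m a2.
pose delta := a - p.
(* The orbit of the fixed point is a single point. *)
have [delta0|delta_neq0] := eqVneq delta 0.
  exists 1, 1 => h x h_ge1; apply: counting_le => s s_uniq sE.
  have h1 : 1 <= h `^ alpha by rewrite -[leLHS](powRr0 h) ler_powR // ltW.
  rewrite mul1r; apply: le_trans h1; rewrite lern1.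
  rewrite -[1%N]/(size [:: p]); apply: uniq_leq_size => // y ys.
  have [/orbitP[k ->] _] := sE y ys.
  by rewrite -/delta delta0 mulr0 addr0 mem_head.
have d_gt0 : 0 < `|delta| by rewrite normr_gt0.
pose K := K0%:R + C * (4 / `|delta|) `^ alpha.
exists (1 + `|delta|), K => h x h_ge; apply: counting_le => s s_uniq sE.
have h_ge1 : 1 <= h by apply: le_trans h_ge; rewrite lerDl.
have h_gt0 : 0 < h by apply: lt_le_trans h_ge1.
have h_ged : `|delta| <= h by apply: le_trans h_ge; rewrite lerDr.
have h1 : 1 <= h `^ alpha by rewrite -[leLHS](powRr0 h) ler_powR // ltW.
pose f y := (y - p) / delta.
have f_inj : injective f.
  by move=> y z /(divIf delta_neq0) /addIr.
pose H := 2 * h / `|delta|.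
have H_ge1 : 1 <= H by rewrite ler_pdivlMr // mul1r; lra.
have [|y|||le_K0|[n [le_n le_s]]] := clusterP (map f s) H.
- by rewrite map_inj_uniq.
- case/mapP => z zs ->; have [/orbitP[k ->] _] := sE z zs.
  by exists k; rewrite /f addrC addKr mulfK.
- exact: H_ge1.
- move=> _ _ /mapP[y ys ->] /mapP[z zs ->].
  rewrite /f -mulrBl normrM normfV ler_pM2r ?invr_gt0 //.
  have [_ /= /andP[y1 y2]] := sE y ys; have [_ /= /andP[z1 z2]] := sE z zs.
  rewrite ler_norml; apply/andP; split; lra.
- rewrite size_map in le_K0; apply: (@le_trans _ _ K0%:R);
  first by rewrite ler_nat.
  rewrite mulrDl -[leLHS]addr0 lerD //; first by rewrite ler_peMr.
  by rewrite !mulr_ge0 ?powR_ge0 // ltW.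
have Hal : (4 * H ^+ 2) `^ (alpha / 2) = (4 / `|delta|) `^ alpha * h `^ alpha.
  have H_ge0 : 0 <= 2 * H by rewrite mulr_ge0 // (le_trans ler01).
  have -> : 4 * H ^+ 2 = (2 * H) ^+ 2 by ring.
  rewrite -powR_mulrn // -powRrM.
  have -> : 2%:R * (alpha / 2) = alpha by field.
  rewrite -powRM ?divr_ge0 // ?(ltW h_gt0) //; congr (_ `^ _).
  by rewrite /H; field; rewrite normr_eq0.
rewrite size_map in le_s.
apply: (@le_trans _ _ (n.+1%:R ^+ m)).
  by rewrite -natrX ler_nat (leq_trans le_s) // card_ord.
apply: (le_trans (leC n _ le_n)); rewrite Hal mulrA /K [leRHS]mulrDl lerDr.
by rewrite mulr_ge0 ?powR_ge0.
Qed.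

Lemma beurling_dim_degenerate a :
  degenerate F -> beurling_dim (forward_orbit F a) = 0%E.
Proof.
move=> [p Fp]; apply/eqP; rewrite eq_le; apply/andP; split; last first.
  by apply/ereal_infP => _ [alpha [alpha_gt0 _] <-]; rewrite lee_fin ltW.
apply/lee_addgt0Pr => alpha alpha_gt0; rewrite add0e.
apply: ge_ereal_inf; exists alpha%:E => //; exists alpha => //; split=> //.
have [h0 [K leK]] := orbit_count_le a Fp alpha_gt0.
apply: (@le_lt_trans _ _ K%:E); last exact: ltry.
apply: ge_ereal_inf.
exists (ereal_sup [set ereal_sup (range (fun x : R =>
       (counting (forward_orbit F a `&` [set y | (x - h <= y <= x + h)%R]) *
        ((h `^ alpha)^-1)%:E)%E)) | h in [set h | Num.max h0 1 <= h]]).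
  exists [set h | Num.max h0 1 <= h] => //.
  by apply: nbhs_pinfty_ge; exact: num_real.
apply/ereal_supP => _ [h /= + <-]; rewrite ge_max => /andP[h0h h_ge1].
apply/ereal_supP => _ [x _ <-].
have ha_gt0 : 0 < h `^ alpha by rewrite powR_gt0 // (lt_le_trans ltr01).
apply: (@le_trans _ _ ((K * h `^ alpha)%:E * ((h `^ alpha)^-1)%:E)%E).
  by apply: lee_wpmul2r; [rewrite lee_fin invr_ge0 ltW | exact: leK].
by rewrite -EFinM mulfK // gt_eqF.
Qed.

End System.

Unset Implicit Arguments.

Theorem proposition4p14 (R : realType) (m : nat) (r b : 'I_m -> R)
    (m_gt0 : (0 < m)%N)
    (r_gt1 : forall i : 'I_m, 1 < `|r i|)
    (distinct : injective (affine_system r b)) :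
  (growth_dim (affine_system r b) = 0 <-> degenerate (affine_system r b)) /\
  (degenerate (affine_system r b) ->
   (forall i : 'I_m, algebraicOver (ratr : rat -> R) (r i)) ->
   forall a : R, beurling_dim (forward_orbit (affine_system r b) a) = 0%E).
Proof.
have [rho rho_gt1 rho_le] : exists2 rho : R, 1 < rho & forall i, rho <= `|r i|.
  have enum_neq0 : enum 'I_m != [::] by rewrite -size_eq0 size_enum_ord -lt0n.
  have [i _ imin] := seq_argmax (fun i => - `|r i|) enum_neq0.
  exists `|r i|; first exact: r_gt1.
  by move=> j; rewrite -lerN2 imin // mem_enum.
split; last first.
  move=> deg alg_r a.
  exact: beurling_dim_degenerate rho_gt1 rho_le alg_r _ deg.
split; last exact: growth_dim_degenerate rho_gt1 rho_le.
move=> dim0; apply: contrapT => ndeg.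
by have := growth_dim_nondegenerate rho_gt1 rho_le m_gt0 ndeg;
  rewrite dim0 eqxx.
Qed.
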